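(* Let $k$ be a field, $G=(V,E,s,t)$ a quiver, $C=PC(G)$ its path coalgebra, and let $D$ be a subcoalgebra of $C$. The following statements are equivalent: (a) $D$ is prime; (b) for any vertices $a,b\in V$ (possibly equal), if $e\in C^\ast$ is the idempotent element given by the characteristic function of $\{a,b\}$, then the coalgebra $e\cdot D\cdot e\subseteq e\cdot C\cdot e$ is prime.
   Context: A quiver $G=(V,E,s,t)$ consists of sets $V$ (vertices) and $E$ (arrows) and maps $s,t:E\to V$ (source and tail). A path is a finite sequence of arrows $p=x_1\cdots x_n$ with $t(x_i)=s(x_{i+1})$. Vertices are paths of length $0$; concatenation with a trivial path at the appropriate end leaves a path unchanged. The path coalgebra $PC(G)$ is the $k$-vector space with basis the set of all paths, with $\Delta(p)=\sum_{p_1p_2=p}p_1\otimes p_2$ (sum over all ways of writing $p$ as a concatenation, so $\Delta(a)=a\otimes a$ for a vertex $a$), $\varepsilon(a)=1$ for vertices $a$ and $\varepsilon(p)=0$ for paths of positive length. For subcoalgebras $A,B$ of a coalgebra $C$, the wedge is $A\wedge^C B=\Delta^{-1}(C\otimes B+A\otimes C)$. A coalgebra $C$ is prime if for any subcoalgebras $A,B$ of $C$ with $C=A\wedge^C B$, either $C=A$ or $C=B$ (for the zero coalgebra this holds trivially). $C^\ast$ is the dual algebra of $C$ with the convolution product. For $e\in C^\ast$ and $x\in C$, in Sweedler notation, $e\cdot x\cdot e=\sum e(x_1)\,x_2\,e(x_3)$. For an idempotent $e\in C^\ast$, the space $e\cdot C\cdot e=\{e\cdot x\cdot e\mid x\in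 C\}$ is a coalgebra with $\Delta(e\cdot x\cdot e)=\sum (e\cdot x_1\cdot e)\otimes(e\cdot x_2\cdot e)$ and $\varepsilon(e\cdot x\cdot e)=e(e\cdot x\cdot e)$; for a subcoalgebra $D\subseteq C$, $e\cdot D\cdot e=\{e\cdot x\cdot e\mid x\in D\}$ is a subcoalgebra of $e\cdot C\cdot e$. The characteristic function of a set $X$ of vertices is the linear map $e:PC(G)\to k$ with $e(v)=1$ for $v\in X$ and $e(p)=0$ for every other path $p$. *)

(* Defs.v *)
From HB Require Import structures.
From mathcomp Require Import all_boot all_algebra.
From mathcomp Require Import boolp classical_sets.
From mathcomp.multinomials Require Import freeg.

Set Implicit Arguments.
Unset Strict Implicit.
Unset Printing Implicit Defensive.

Import GRing.Theory.
Local Open Scope quotient_scope.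
Local Open Scope classical_set_scope.
Local Open Scope ring_scope.

Record subspace (k : fieldType) (V : lmodType k) := Subspace {
  sset :> set V;
  subspace0 : sset 0;
  subspace_linear : forall (c : k) (x y : V),
    sset x -> sset y -> sset (c *: x + y)
}.

Section SubspaceTheory.
Variables (k : fieldType) (V : lmodType k) (S : subspace V).

Lemma subspaceD x y : sset S x -> sset S y -> sset S (x + y).
Proof. by move=> Sx Sy; rewrite -[x]scale1r; apply: subspace_linear. Qed.

Lemma subspaceZ c x : sset S x -> sset S (c *: x).
Proof.
by move=> Sx; rewrite -[_ *: _]addr0; apply: subspace_linear => //; apply: subspace0.
Qed.

Lemma subspaceN x : sset S x -> sset S (- x).
Proof. by rewrite -scaleN1r; apply: subspaceZ. Qed.

Lemma subspaceB x y : sset S x -> sset S y -> sset S (x - y).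
Proof. by move=> Sx Sy; apply: subspaceD => //; apply: subspaceN. Qed.

Definition subspace_pred : {pred V} := fun x => `[< sset S x >].

Lemma subspace_submod_closed : GRing.submod_closed subspace_pred.
Proof.
split=> [|c x y /asboolP Sx /asboolP Sy]; apply/asboolP.
  exact: subspace0.
exact: subspace_linear.
Qed.

HB.instance Definition _ :=
  GRing.isSubmodClosed.Build k V subspace_pred subspace_submod_closed.

Record subspace_type := SubspaceElt {
  subspace_val : V;
  subspace_val_in : subspace_val \in subspace_pred
}.

HB.instance Definition _ := [isSub for subspace_val].
HB.instance Definition _ := [Choice of subspace_type by <:].
HB.instance Definition _ := [SubChoice_isSubZmodule of subspace_type by <:].
HB.instance Definition _ := [SubZmodule_isSubLmodule of subspace_type by <:].

Lemma subspace_valP (x : subspace_type) : sset S (val x).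
Proof. exact/asboolP/(valP x). Qed.

Definition subspace_elt x (Sx : sset S x) : subspace_type :=
  SubspaceElt (asboolT Sx).

End SubspaceTheory.

Section FreeModule.
Variables (k : fieldType) (K : choiceType).

Definition fgen (x : K) : {freeg K / k} := Freeg [:: (1, x)].

Lemma freeg_ext_ind (P : {freeg K / k} -> Prop) :
    P 0 -> (forall c x D, P D -> P (c *: fgen x + D)) -> forall D, P D.
Proof.
move=> P0 PS; apply: freeg_ind_dom0 => // c x D _ _ PD.
rewrite (_ : Freeg _ = c *: fgen x); first exact: PS.
by apply/eqP/freeg_eqP => y; rewrite coeffZ !coeffU mul1r.
Qed.

Section Lift.
Variables (W : lmodType k) (f : K -> W).

Lemma fglift_add x y : fglift f (x + y) = fglift f x + fglift f y.
Proof.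
have add := @lift_is_additive k K W f.
have f0 : fglift f 0 = 0 by rewrite -[X in fglift f X](subrr 0) add subrr.
by rewrite -{1}[y]opprK add -[- y]add0r add f0 sub0r opprK.
Qed.

Lemma fglift_scale c x : fglift f (c *: x) = c *: fglift f x.
Proof.
have f0 : fglift f 0 = 0.
  by rewrite -[X in fglift f X](subrr 0) lift_is_additive subrr.
elim/freeg_ext_ind: x => [|d x D IH]; first by rewrite scaler0 f0 scaler0.
have fZ a : fglift f (a *: fgen x) = a *: f x.
  rewrite (_ : a *: fgen x = Freeg [:: (a, x)]) ?liftU //.
  by apply/eqP/freeg_eqP => y; rewrite coeffZ !coeffU mul1r.
by rewrite scalerDr !fglift_add IH scalerA !fZ scalerDr scalerA.
Qed.

Lemma fglift_linear : linear (fglift f).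
Proof. by move=> c x y; rewrite fglift_add fglift_scale. Qed.

HB.instance Definition _ :=
  GRing.isLinear.Build k {freeg K / k} W *:%R (fglift f) fglift_linear.

Lemma fglift_gen x : fglift f (fgen x) = f x.
Proof. by rewrite liftU scale1r. Qed.

End Lift.
End FreeModule.

Section Tensor.
Variables (k : fieldType) (U V : lmodType k).

Local Notation F := {freeg (U * V)%type / k}.
Local Notation "[ u , v ]" := (fgen k (u : U, v : V)) (at level 0).

Definition bilinear_relations : set F :=
  [set z |
    (exists c u u' v, z = [c *: u + u', v] - (c *: [u, v] + [u', v])) \/
    (exists c u v v', z = [u, c *: v + v'] - (c *: [u, v] + [u, v']))].

(** The subspace generated by the relations, as the intersection of all
    subspaces containing them. *)
Definition tensor_ker : {pred F} :=
  fun z => `[< forall S : subspace F, bilinear_relations `<=` S -> sset S z >].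

Lemma tensor_ker_submod_closed : GRing.submod_closed tensor_ker.
Proof.
split=> [|c x y /asboolP kx /asboolP ky]; apply/asboolP => S relS.
  exact: subspace0.
by apply: subspace_linear; [apply: kx | apply: ky].
Qed.

HB.instance Definition _ :=
  GRing.isSubmodClosed.Build k F tensor_ker tensor_ker_submod_closed.

Definition tensor_type : Type := Quotient.quot tensor_ker.

HB.instance Definition _ := GRing.Zmodule.on tensor_type.

Definition tpi (x : F) : tensor_type := \pi_(Quotient.quot tensor_ker) x.

Lemma tpi_add x y : tpi (x + y) = tpi x + tpi y.
Proof. exact: raddfD. Qed.

Lemma tpi_eq x y : (x - y \in tensor_ker) -> tpi x = tpi y.
Proof. by rewrite Quotient.idealrBE => /eqP. Qed.

Lemma tpi_eqP x y : tpi x = tpi y -> x - y \in tensor_ker.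
Proof. by rewrite Quotient.idealrBE => /eqP. Qed.

Lemma tpi_repr (t : tensor_type) : tpi (repr t) = t.
Proof. exact: reprK. Qed.

Definition tscale (c : k) (t : tensor_type) : tensor_type := tpi (c *: repr t).

Lemma tscale_pi c x : tscale c (tpi x) = tpi (c *: x).
Proof.
apply: tpi_eq; rewrite -scalerBr rpredZ //.
by apply: tpi_eqP; rewrite tpi_repr.
Qed.

Lemma tscaleA a b t : tscale a (tscale b t) = tscale (a * b) t.
Proof. by rewrite -[t]tpi_repr !tscale_pi scalerA. Qed.

Lemma tscale1 : left_id 1 tscale.
Proof. by move=> t; rewrite -[t]tpi_repr tscale_pi scale1r. Qed.

Lemma tscaleDr : right_distributive tscale +%R.
Proof.
by move=> c s t; rewrite -[s]tpi_repr -[t]tpi_repr -tpi_add !tscale_pi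
  scalerDr tpi_add.
Qed.

Lemma tscaleDl t : {morph tscale^~ t : a b / a + b}.
Proof. by move=> a b; rewrite -[t]tpi_repr !tscale_pi scalerDl tpi_add. Qed.

HB.instance Definition _ :=
  GRing.Zmodule_isLmodule.Build k tensor_type tscaleA tscale1 tscaleDr tscaleDl.

Definition tensor : lmodType k := GRing.Lmodule.clone k tensor_type _.

Lemma tpi_linear : linear (tpi : F -> tensor).
Proof. by move=> c x y; rewrite tpi_add -tscale_pi. Qed.

Definition tens (u : U) (v : V) : tensor := tpi [u, v].

Lemma tens_bilinear : bilinear_for *:%R *:%R tens.
Proof.
split=> [v c u u'|u c v v']; rewrite /tens -tpi_linear; apply: tpi_eq;
  apply/asboolP => S; apply.
- by left; exists c, u, u', v.
- by right; exists c, u, v, v'.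
Qed.

HB.instance Definition _ :=
  bilinear_isBilinear.Build k U V tensor *:%R *:%R tens tens_bilinear.

Lemma tensor_ind (P : tensor -> Prop) :
    P 0 -> (forall u v, P (tens u v)) ->
    (forall s t, P s -> P t -> P (s + t)) -> forall t, P t.
Proof.
move=> P0 Pt PD t; rewrite -[t]tpi_repr.
elim/freeg_ext_ind: (repr t) => [|c [u v] D IH].
  by rewrite (_ : tpi 0 = 0) //; exact: raddf0.
rewrite tpi_add; apply: PD => //.
rewrite -tscale_pi -/(tens u v) (_ : tscale c _ = tens (c *: u) v) //.
by rewrite linearZl_LR.
Qed.

Section Lift.
Variables (W : lmodType k) (f : {bilinear U -> V -> W}).

Definition tlift (t : tensor) : W := fglift (fun p => f p.1 p.2) (repr t).

Let ker_lift : subspace F.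
Proof.
exists [set z | fglift (fun p => f p.1 p.2) z = 0]; first exact: linear0.
by move=> c x y fx fy; rewrite /mkset fglift_linear fx fy scaler0 addr0.
Defined.

Lemma tlift_pi x : tlift (tpi x) = fglift (fun p => f p.1 p.2) x.
Proof.
apply/eqP; rewrite -subr_eq0 -linearB; apply/eqP.
have /tpi_eqP/asboolP/(_ ker_lift) : tpi (repr (tpi x)) = tpi x.
  exact: tpi_repr.
apply=> z [[c [u [u' [v ->]]]]|[c [u [v [v' ->]]]]]; rewrite /sset /= /mkset.
- by rewrite linearB /= fglift_linear !fglift_gen /= linearPl subrr.
- by rewrite linearB /= fglift_linear !fglift_gen /= linearPr subrr.
Qed.

Lemma tlift_linear : linear tlift.
Proof.
move=> c s t; rewrite -[s]tpi_repr -[t]tpi_repr -tpi_linear !tlift_pi.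
exact: linearP.
Qed.

HB.instance Definition _ :=
  GRing.isLinear.Build k tensor W *:%R tlift tlift_linear.

Lemma tliftE u v : tlift (tens u v) = f u v.
Proof. by rewrite /tens tlift_pi fglift_gen. Qed.

End Lift.
End Tensor.

Notation "u ⊗ v" := (tens u v) (at level 40, left associativity).

Section TensorMaps.
Variable k : fieldType.

Section Map.
Variables (U V U' V' : lmodType k).
Variables (f : {linear U -> U'}) (g : {linear V -> V'}).

Definition tmap_fun (u : U) (v : V) : tensor U' V' := f u ⊗ g v.

Lemma tmap_bilinear : bilinear_for *:%R *:%R tmap_fun.
Proof.
by split=> [v c u u'|u c v v']; rewrite /tmap_fun !linearP ?linearPl ?linearPr.
Qed.

HB.instance Definition _ :=
  bilinear_isBilinear.Build k U V (tensor U' V') *:%R *:%R tmap_fun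
    tmap_bilinear.

Definition tmap : {linear tensor U V -> tensor U' V'} := tlift tmap_fun.

Lemma tmapE u v : tmap (u ⊗ v) = f u ⊗ g v.
Proof. exact: tliftE. Qed.

End Map.

Lemma tmap_comp (U V U' V' U'' V'' : lmodType k)
    (f : {linear U -> U'}) (g : {linear V -> V'})
    (f' : {linear U' -> U''}) (g' : {linear V' -> V''})
    (h : {linear U -> U''}) (h' : {linear V -> V''}) :
  (forall x, f' (f x) = h x) -> (forall x, g' (g x) = h' x) ->
  forall t, tmap f' g' (tmap f g t) = tmap h h' t.
Proof.
move=> fh gh; elim/tensor_ind => [|u v|s t IHs IHt]; first by rewrite !linear0.
  by rewrite !tmapE fh gh.
by rewrite !linearD IHs IHt.
Qed.

Lemma tmap_eq (U V U' V' : lmodType k)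
    (f f' : {linear U -> U'}) (g g' : {linear V -> V'}) :
  f =1 f' -> g =1 g' -> tmap f g =1 tmap f' g'.
Proof.
move=> ff gg; elim/tensor_ind => [|u v|s t IHs IHt]; first by rewrite !linear0.
  by rewrite !tmapE ff gg.
by rewrite !linearD IHs IHt.
Qed.

Lemma tmap_id (U V : lmodType k) (f : {linear U -> U}) (g : {linear V -> V}) :
  f =1 id -> g =1 id -> tmap f g =1 id.
Proof.
move=> ff gg; elim/tensor_ind => [|u v|s t IHs IHt]; first by rewrite linear0.
  by rewrite tmapE ff gg.
by rewrite linearD IHs IHt.
Qed.

Section Assoc.
Variables (U V W : lmodType k).

Definition tassoc_fun2 (w : W) (u : U) (v : V) : tensor U (tensor V W) :=
  u ⊗ (v ⊗ w).

Lemma tassoc_bilinear2 w : bilinear_for *:%R *:%R (tassoc_fun2 w).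
Proof.
by split=> [v c u u'|u c v v']; rewrite /tassoc_fun2 ?linearPl ?linearPr.
Qed.

HB.instance Definition _ w :=
  bilinear_isBilinear.Build k U V (tensor U (tensor V W)) *:%R *:%R
    (tassoc_fun2 w) (tassoc_bilinear2 w).

Definition tassoc_fun (t : tensor U V) (w : W) : tensor U (tensor V W) :=
  tlift (tassoc_fun2 w) t.

Lemma tassoc_bilinear : bilinear_for *:%R *:%R tassoc_fun.
Proof.
split=> [w c s t|t c w w']; rewrite /tassoc_fun ?linearP //.
elim/tensor_ind: t => [|u v|s t IHs IHt].
- by rewrite !linear0 /= scaler0 addr0.
- by rewrite !tliftE /= /tassoc_fun2 !linearPr.
- by rewrite !linearD [LHS]/= IHs IHt /= scalerDr addrACA.
Qed.

HB.instance Definition _ :=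
  bilinear_isBilinear.Build k (tensor U V) W (tensor U (tensor V W)) *:%R *:%R
    tassoc_fun tassoc_bilinear.

Definition tassoc : {linear tensor (tensor U V) W -> tensor U (tensor V W)} :=
  tlift tassoc_fun.

Lemma tassocE u v w : tassoc (u ⊗ v ⊗ w) = u ⊗ (v ⊗ w).
Proof. by transitivity (tassoc_fun (u ⊗ v) w); exact: tliftE. Qed.

End Assoc.

Arguments tassoc {U V W}.

Lemma tassoc_map (U V W U' V' W' : lmodType k) (f : {linear U -> U'})
    (g : {linear V -> V'}) (h : {linear W -> W'}) t :
  tassoc (tmap (tmap f g) h t) = tmap f (tmap g h) (tassoc t).
Proof.
elim/tensor_ind: t => [|s w|s t IHs IHt]; first by rewrite !linear0.
  elim/tensor_ind: s => [|u v|s t IHs IHt].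
  - by rewrite linear0l !linear0.
  - by rewrite !(tassocE, tmapE).
  - by rewrite linearDl !linearD IHs IHt.
by rewrite !linearD IHs IHt.
Qed.

Section Contraction.
Variables (U V : lmodType k) (f : {linear U -> k^o}).

Definition contl_fun (u : U) (v : V) : V := (f u : k) *: v.

Lemma contl_bilinear : bilinear_for *:%R *:%R contl_fun.
Proof.
split=> [v c u u'|u c v v']; rewrite /contl_fun.
  by rewrite /= linearP scalerDl scalerA.
by rewrite /= scalerDr !scalerA mulrC.
Qed.

HB.instance Definition _ :=
  bilinear_isBilinear.Build k U V V *:%R *:%R contl_fun contl_bilinear.

Definition contl : {linear tensor U V -> V} := tlift contl_fun.

Lemma contlE u v : contl (u ⊗ v) = (f u : k) *: v.
Proof. exact: tliftE. Qed.

Definition contr_fun (v : V) (u : U) : V := (f u : k) *: v.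

Lemma contr_bilinear : bilinear_for *:%R *:%R contr_fun.
Proof.
split=> [v c u u'|u c v v']; rewrite /contr_fun.
  by rewrite /= scalerDr !scalerA mulrC.
by rewrite /= linearP scalerDl scalerA.
Qed.

HB.instance Definition _ :=
  bilinear_isBilinear.Build k V U V *:%R *:%R contr_fun contr_bilinear.

Definition contr : {linear tensor V U -> V} := tlift contr_fun.

Lemma contrE v u : contr (v ⊗ u) = (f u : k) *: v.
Proof. exact: tliftE. Qed.

End Contraction.

Arguments contl {U V} f.
Arguments contr {U V} f.

(** For subspaces [A] and [B], this is [A ⊗ B] viewed inside [U ⊗ V]. *)
Definition tsub (U V : lmodType k) (A : set U) (B : set V) : set (tensor U V) :=
  [set t | exists s : seq (U * V),
     (forall p, p \in s -> A p.1 /\ B p.2) /\ t = \sum_(p <- s) p.1 ⊗ p.2].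

Lemma tsub_ind (U V : lmodType k) (A : set U) (B : set V)
    (P : tensor U V -> Prop) :
    P 0 -> (forall u v, A u -> B v -> P (u ⊗ v)) ->
    (forall s t, P s -> P t -> P (s + t)) -> forall t, tsub A B t -> P t.
Proof.
move=> P0 Pt PD _ [s [sAB ->]]; rewrite big_seq; apply: (big_ind P) => //.
by move=> p /sAB[]; apply: Pt.
Qed.

Lemma tsub0 (U V : lmodType k) (A : set U) (B : set V) : tsub A B 0.
Proof. by exists [::]; rewrite big_nil. Qed.

Lemma tsub_tens (U V : lmodType k) (A : set U) (B : set V) u v :
  A u -> B v -> tsub A B (u ⊗ v).
Proof.
by move=> Au Bv; exists [:: (u, v)]; rewrite big_seq1; split=> // p /[!inE]/eqP->.
Qed.

Lemma tsubD (U V : lmodType k) (A : set U) (B : set V) s t :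
  tsub A B s -> tsub A B t -> tsub A B (s + t).
Proof.
move=> [p [pAB ->]] [q [qAB ->]]; exists (p ++ q); rewrite big_cat; split=> // x.
by rewrite mem_cat => /orP[/pAB|/qAB].
Qed.

End TensorMaps.

Arguments tassoc {k U V W}.
Arguments contl {k U V} f.
Arguments contr {k U V} f.
Arguments tmap : simpl never.
Arguments tassoc : simpl never.
Arguments contl : simpl never.
Arguments contr : simpl never.

Record coalgebra (k : fieldType) := Coalgebra {
  coalg_sort :> lmodType k;
  comul : {linear coalg_sort -> tensor coalg_sort coalg_sort};
  counit : {linear coalg_sort -> k^o};
  comulA : forall x, tassoc (tmap comul idfun (comul x))
                     = tmap idfun comul (comul x);
  counitl : forall x, contl counit (comul x) = x;
  counitr : forall x, contr counit (comul x) = x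
}.

Arguments comul {k c}.
Arguments counit {k c}.

Record subcoalgebra (k : fieldType) (C : coalgebra k) := Subcoalgebra {
  subcoalg_subspace :> subspace C;
  subcoalgP : forall x, sset subcoalg_subspace x ->
    tsub subcoalg_subspace subcoalg_subspace (comul x)
}.

Definition wedge (k : fieldType) (C : coalgebra k) (A B : set C) : set C :=
  [set x | exists s t, [/\ tsub [set: C] B s, tsub A [set: C] t
                         & comul x = s + t]].

Definition prime_coalgebra (k : fieldType) (C : coalgebra k) : Prop :=
  forall A B : subcoalgebra C,
    [set: C] = wedge A B -> [set: C] = A \/ [set: C] = B.

Section Retraction.
Variables (k : fieldType) (V : lmodType k) (S : subspace V).

Lemma subspace_complement : exists W : subspace V,
  (forall x, sset S x -> sset W x -> x = 0) /\
  (forall x, exists s w, [/\ sset S s, sset W w & x = s + w]).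
Proof.
pose P : set (set V) := [set W |
  (forall (c : k) x y, W x -> W y -> W (c *: x + y)) /\
  (forall x, sset S x -> W x -> x = 0)].
have [F FP totF|W [[Wlin WS] Wmax]] := @Zorn_bigcup V P.
  split=> [c x y [X FX Xx] [Y FY Yy]|x Sx [X /FP[_ XS] Xx]]; last exact: XS.
  have [XY|YX] := totF _ _ FX FY.
    by exists Y => //; apply: (FP _ FY).1 => //; apply: XY.
  by exists X => //; apply: (FP _ FX).1 => //; apply: YX.
have W0 : W 0.
  apply: contrapT => nW0; apply: (Wmax [set 0]); last first.
    split=> [c x y -> ->|x _ -> //]; by rewrite scaler0 addr0.
  have We : W `<=` set0.
    move=> x Wx; apply: nW0; rewrite -[0](subrr x) addrC -scaleN1r.
    exact: Wlin.
  split=> [x /We//|/(_ 0 erefl)/We//].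
exists (Subspace W0 Wlin); split=> [|v]; first exact: WS.
apply: contrapT => nv.
have nWv : ~ W v.
  by move=> Wv; apply: nv; exists 0, v; rewrite add0r; split=> //; apply: subspace0.
pose W' : set V := [set x | exists c w, W w /\ x = w + c *: v].
apply: (Wmax W').
  split=> [x Wx|W'W]; first by exists 0, x; rewrite scale0r addr0.
  by apply/nWv/W'W; exists 1, 0; rewrite scale1r add0r.
split=> [a _ _ [c [w [Ww ->]]] [c' [w' [Ww' ->]]]|x Sx [c [w [Ww xE]]]].
  exists (a * c + c'), (a *: w + w'); split; first exact: (Wlin _ _ _ Ww Ww').
  by rewrite scalerDr scalerA scalerDl addrACA.
have [c0|c0] := eqVneq c 0.
  by apply: WS => //; rewrite xE c0 scale0r addr0.
case: nv; exists (c^-1 *: x), (- c^-1 *: w); split.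
- exact: subspaceZ.
- by rewrite -[_ *: w]addr0; apply: (Wlin _ _ _ Ww W0).
- by rewrite xE scalerDr scaleNr addrAC subrr add0r scalerA mulVf // scale1r.
Qed.

Lemma subspace_retraction_ex :
  exists r : {linear V -> subspace_type S}, forall x, r (val x) = x.
Proof.
have [W [SW dec]] := subspace_complement.
have uniq s s' w w' : sset S s -> sset S s' -> sset W w -> sset W w' ->
    s + w = s' + w' -> s = s'.
  move=> Ss Ss' Ww Ww' E; apply/eqP; rewrite -subr_eq0; apply/eqP/SW.
    exact: subspaceB.
  suff -> : s - s' = w' - w by exact: subspaceB.
  by apply/eqP; rewrite subr_eq addrAC eq_sym subr_eq addrC -E addrC.
have /choice[r rP] : forall x, exists y : subspace_type S,
    sset W (x - val y).
  move=> x; have [s [w [Ss Ww ->]]] := dec x.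
  by exists (subspace_elt Ss); rewrite /= addrAC subrr add0r.
have subK (s t : V) : s + (t - s) = t by rewrite addrC subrK.
have rlin : linear r.
  move=> c x y; apply: val_inj.
  apply: (uniq _ _ (c *: x + y - val (r (c *: x + y)))
                   (c *: (x - val (r x)) + (y - val (r y)))).
  - exact: subspace_valP.
  - exact: subspace_valP.
  - exact: rP.
  - by apply: subspace_linear.
  - by rewrite subK linearP /= addrACA -scalerDr !subK.
pose rL := GRing.isLinear.Build k V (subspace_type S) *:%R r rlin.
pose r' : {linear V -> subspace_type S} := HB.pack r rL.
exists r' => x; apply: val_inj.
apply: (uniq _ _ (val x - val (r (val x))) 0).
- exact: subspace_valP.
- exact: subspace_valP.
- exact: rP.
- exact: subspace0.
- by rewrite addr0 addrC subrK.
Qed.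

Definition subspace_incl : {linear subspace_type S -> V} :=
  GRing.Linear.clone _ _ _ _ (\val : subspace_type S -> V) _.

Definition subspace_retraction : {linear V -> subspace_type S} :=
  projT1 (cid subspace_retraction_ex).

Lemma subspace_retractionK x : subspace_retraction (subspace_incl x) = x.
Proof. exact: (projT2 (cid subspace_retraction_ex)). Qed.

Lemma subspace_retraction_in x :
  sset S x -> subspace_incl (subspace_retraction x) = x.
Proof.
by move=> Sx; rewrite -[x]/(subspace_incl (subspace_elt Sx)) subspace_retractionK.
Qed.

End Retraction.

Section SubcoalgebraCoalgebra.
Variables (k : fieldType) (C : coalgebra k) (D : subcoalgebra C).

Local Notation i := (subspace_incl D).
Local Notation r := (subspace_retraction D).

(** As [tmap i i] is injective, [subcoalg_comulE] characterizes this map: the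
    retraction only serves to invert [tmap i i] on its image [D ⊗ D]. *)
Definition subcoalg_comul :
    {linear subspace_type D -> tensor (subspace_type D) (subspace_type D)} :=
  GRing.Linear.clone _ _ _ _ (tmap r r \o comul \o i) _.

Definition subcoalg_counit : {linear subspace_type D -> k^o} :=
  GRing.Linear.clone _ _ _ _ (counit \o i) _.

Lemma subcoalg_comulE x : tmap i i (subcoalg_comul x) = comul (i x).
Proof.
have /subcoalgP : sset D (i x) by exact: subspace_valP.
rewrite (_ : subcoalg_comul x = tmap r r (comul (i x))) //.
elim/tsub_ind => [|u v Du Dv|s t IHs IHt].
- by rewrite !linear0.
- by rewrite !tmapE !subspace_retraction_in.
- by rewrite !linearD IHs IHt.
Qed.

Lemma subspace_incl_inj : injective i.
Proof. exact: val_inj. Qed.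

Lemma subcoalg_comulA x :
  tassoc (tmap subcoalg_comul idfun (subcoalg_comul x))
  = tmap idfun subcoalg_comul (subcoalg_comul x).
Proof.
have ii_inj : injective (tmap i (tmap i i)).
  apply: (can_inj (g := tmap r (tmap r r))) => t.
  rewrite (tmap_comp (h := idfun) (h' := idfun)) ?tmap_id // => y.
    exact: subspace_retractionK.
  rewrite (tmap_comp (h := idfun) (h' := idfun)) ?tmap_id // => z;
    exact: subspace_retractionK.
apply: ii_inj; rewrite -tassoc_map.
pose ci : {linear subspace_type D -> tensor C C} :=
  GRing.Linear.clone _ _ _ _ (comul \o i) _.
rewrite (tmap_comp (h := ci) (h' := i)) //; last exact: subcoalg_comulE.
rewrite (tmap_comp (h := i) (h' := ci)) //; last exact: subcoalg_comulE.
rewrite -(tmap_comp (f := i) (g := i) (f' := comul) (g' := idfun)) //.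
rewrite -(tmap_comp (f := i) (g := i) (f' := idfun) (g' := comul)) //.
by rewrite subcoalg_comulE comulA.
Qed.

Lemma subcoalg_counitl x : contl subcoalg_counit (subcoalg_comul x) = x.
Proof.
apply: subspace_incl_inj; rewrite -[RHS]counitl -subcoalg_comulE.
elim/tensor_ind: (subcoalg_comul x) => [|u v|s t IHs IHt].
- by rewrite !linear0.
- by rewrite tmapE !contlE linearZ.
- by rewrite !linearD IHs IHt.
Qed.

Lemma subcoalg_counitr x : contr subcoalg_counit (subcoalg_comul x) = x.
Proof.
apply: subspace_incl_inj; rewrite -[RHS]counitr -subcoalg_comulE.
elim/tensor_ind: (subcoalg_comul x) => [|u v|s t IHs IHt].
- by rewrite !linear0.
- by rewrite tmapE !contrE linearZ.
- by rewrite !linearD IHs IHt.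
Qed.

Definition subcoalgebra_coalgebra : coalgebra k :=
  Coalgebra subcoalg_comulA subcoalg_counitl subcoalg_counitr.

End SubcoalgebraCoalgebra.

Section DualAlgebra.
Variables (k : fieldType) (C : coalgebra k).

(** [(f * g)(x) = \sum f(x_1) g(x_2)] *)
Definition convolution (f g : {linear C -> k^o}) : {linear C -> k^o} :=
  GRing.Linear.clone _ _ _ _ (contl f \o tmap idfun g \o comul) _.

Record dual_idempotent := DualIdempotent {
  idem :> {linear C -> k^o};
  idemP : convolution idem idem =1 idem
}.

(** [e . x . e = \sum e(x_1) x_2 e(x_3)] *)
Definition sandwich (e : {linear C -> k^o}) : {linear C -> C} :=
  GRing.Linear.clone _ _ _ _
    (contr e \o contl e \o tmap idfun comul \o comul) _.

End DualAlgebra.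

Section ContractionTheory.
Variable k : fieldType.

Lemma contl_map (U V W : lmodType k) (f : {linear U -> k^o})
    (g : {linear V -> W}) t :
  contl f (tmap idfun g t) = g (contl f t).
Proof.
elim/tensor_ind: t => [|u v|s t IHs IHt]; first by rewrite !linear0.
  by rewrite tmapE !contlE linearZ.
by rewrite !linearD IHs IHt.
Qed.

Lemma contr_map (U V W : lmodType k) (f : {linear U -> k^o})
    (g : {linear V -> W}) t :
  contr f (tmap g idfun t) = g (contr f t).
Proof.
elim/tensor_ind: t => [|v u|s t IHs IHt]; first by rewrite !linear0.
  by rewrite tmapE !contrE linearZ.
by rewrite !linearD IHs IHt.
Qed.

Lemma contl_map2 (U U' V V' : lmodType k) (f : {linear U -> k^o})
    (f' : {linear U' -> k^o}) (g : {linear U -> U'}) (h : {linear V -> V'}) t :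
  (forall u, f' (g u) = f u) -> contl f' (tmap g h t) = h (contl f t).
Proof.
move=> fg; elim/tensor_ind: t => [|u v|s t IHs IHt]; first by rewrite !linear0.
  by rewrite tmapE !contlE linearZ fg.
by rewrite !linearD IHs IHt.
Qed.

Lemma contr_map2 (U U' V V' : lmodType k) (f : {linear U -> k^o})
    (f' : {linear U' -> k^o}) (g : {linear U -> U'}) (h : {linear V -> V'}) t :
  (forall u, f' (g u) = f u) -> contr f' (tmap h g t) = h (contr f t).
Proof.
move=> fg; elim/tensor_ind: t => [|v u|s t IHs IHt]; first by rewrite !linear0.
  by rewrite tmapE !contrE linearZ fg.
by rewrite !linearD IHs IHt.
Qed.

Section Assoc.
Variables (U V W : lmodType k).

Lemma tensor3_ind (P : tensor (tensor U V) W -> Prop) :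
    P 0 -> (forall u v w, P (u ⊗ v ⊗ w)) ->
    (forall s t, P s -> P t -> P (s + t)) -> forall t, P t.
Proof.
move=> P0 Pt PD; elim/tensor_ind => // s w.
elim/tensor_ind: s => [|u v|s t IHs IHt] //; first by rewrite linear0l.
by rewrite linearDl; apply: PD.
Qed.

Lemma contl_assoc (f : {linear U -> k^o}) (t : tensor (tensor U V) W) :
  contl f (tassoc t) = tmap (contl f) idfun t.
Proof.
elim/tensor3_ind: t => [|u v w|s t IHs IHt]; first by rewrite !linear0.
  by rewrite tassocE tmapE !contlE linearZl_LR.
by rewrite !linearD IHs IHt.
Qed.

Lemma contr_assoc (f : {linear W -> k^o}) (t : tensor (tensor U V) W) :
  contr f t = tmap idfun (contr f) (tassoc t).
Proof.
elim/tensor3_ind: t => [|u v w|s t IHs IHt]; first by rewrite !linear0.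
  by rewrite tassocE tmapE !contrE linearZr_LR.
by rewrite !linearD IHs IHt.
Qed.

Lemma contlr_assoc (f : {linear U -> k^o}) (g : {linear W -> k^o})
    (t : tensor (tensor U V) W) :
  contl f (contr g t) = contr g (contl f (tassoc t)).
Proof.
elim/tensor3_ind: t => [|u v w|s t IHs IHt]; first by rewrite !linear0.
  rewrite tassocE contrE contlE !linearZ /= contlE contrE.
  by rewrite !scalerA mulrC.
by rewrite !linearD IHs IHt.
Qed.

End Assoc.
End ContractionTheory.

Section Corner.
Variables (k : fieldType) (C : coalgebra k) (e : dual_idempotent C).

Local Notation L x := (contl e (comul x)).
Local Notation R x := (contr e (comul x)).

Lemma sandwichE x : sandwich e x = R (L x).
Proof. by rewrite -contl_map. Qed.

Lemma sandwichE' x : sandwich e x = L (R x).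
Proof. by rewrite -contr_map contlr_assoc comulA. Qed.

Lemma idem_contr x : e (R x) = e x.
Proof.
rewrite -[RHS]idemP -[RHS]/(contl e (tmap idfun e (comul x))).
elim/tensor_ind: (comul x) => [|u v|s t IHs IHt]; first by rewrite !linear0.
  by rewrite tmapE contrE contlE linearZ; exact: mulrC.
by rewrite !linearD IHs IHt.
Qed.

Lemma idem_contl x : e (L x) = e x.
Proof. by rewrite -contl_map; exact: idemP. Qed.

Lemma comul_contl x (Lc : {linear C -> C}) : (forall y, Lc y = L y) ->
  comul (L x) = tmap Lc idfun (comul x).
Proof.
move=> LcE; rewrite -contl_map -comulA contl_assoc.
by apply: tmap_comp => // y.
Qed.

Lemma comul_contr x (Rc : {linear C -> C}) : (forall y, Rc y = R y) ->
  comul (R x) = tmap idfun Rc (comul x).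
Proof.
move=> RcE; rewrite -contr_map contr_assoc comulA.
by apply: tmap_comp => // y.
Qed.

Let Ll : {linear C -> C} := GRing.Linear.clone _ _ _ _ (contl e \o comul) _.
Let Rl : {linear C -> C} := GRing.Linear.clone _ _ _ _ (contr e \o comul) _.

Lemma contl_idem x : L (L x) = L x.
Proof.
rewrite (@comul_contl _ Ll) // (contl_map2 (f := e) idfun) // => y.
exact: idem_contl.
Qed.

Lemma contr_idem x : R (R x) = R x.
Proof.
rewrite (@comul_contr _ Rl) // (contr_map2 (f := e) idfun) // => y.
exact: idem_contr.
Qed.

Lemma sandwich_contl x : sandwich e (L x) = sandwich e x.
Proof. by rewrite !sandwichE contl_idem. Qed.

Lemma sandwich_contr x : sandwich e (R x) = sandwich e x.
Proof. by rewrite !sandwichE' contr_idem. Qed.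

Lemma sandwich_idem x : sandwich e (sandwich e x) = sandwich e x.
Proof. by rewrite [X in sandwich e X]sandwichE sandwich_contr sandwich_contl. Qed.

Lemma idem_sandwich x : e (sandwich e x) = e x.
Proof. by rewrite sandwichE idem_contr idem_contl. Qed.

Lemma corner_subproof0 : range (sandwich e) 0.
Proof. by exists 0; rewrite ?linear0. Qed.

Lemma corner_subproof_linear (c : k) x y :
  range (sandwich e) x -> range (sandwich e) y ->
  range (sandwich e) (c *: x + y).
Proof. by move=> [u _ <-] [v _ <-]; exists (c *: u + v); rewrite ?linearP. Qed.

Definition corner : subspace C :=
  Subspace corner_subproof0 corner_subproof_linear.

Definition corner_proj_fun (x : C) : subspace_type corner :=
  subspace_elt (imageT (sandwich e) x : sset corner (sandwich e x)).

Lemma corner_proj_linear : linear corner_proj_fun.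
Proof.
by move=> c x y; apply: val_inj; rewrite [RHS]linearP; exact: (linearP (sandwich e)).
Qed.

HB.instance Definition _ :=
  GRing.isLinear.Build k C (subspace_type corner) *:%R corner_proj_fun
    corner_proj_linear.

Definition corner_proj : {linear C -> subspace_type corner} :=
  GRing.Linear.clone _ _ _ _ corner_proj_fun _.

Lemma val_corner_proj x : val (corner_proj x) = sandwich e x.
Proof. by []. Qed.

Lemma corner_projK (y : subspace_type corner) :
  corner_proj (subspace_incl corner y) = y.
Proof.
apply: val_inj; rewrite val_corner_proj -[subspace_incl corner y]/(val y).
by have [x _ <-] := subspace_valP y; rewrite sandwich_idem.
Qed.

(** [corner_comulE] shows that this does not depend on the representative [x]
    chosen for an element [e . x . e]. *)
Definition corner_comul : {linear subspace_type corner ->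
    tensor (subspace_type corner) (subspace_type corner)} :=
  GRing.Linear.clone _ _ _ _
    (tmap corner_proj corner_proj \o comul \o subspace_incl corner) _.

Definition corner_counit : {linear subspace_type corner -> k^o} :=
  GRing.Linear.clone _ _ _ _ (e \o subspace_incl corner) _.

(** [Delta(e . x . e) = \sum (e . x_1 . e) ⊗ (e . x_2 . e)] *)
Lemma corner_comulE x :
  corner_comul (corner_proj x) = tmap corner_proj corner_proj (comul x).
Proof.
rewrite -[LHS]/(tmap corner_proj corner_proj (comul (sandwich e x))) sandwichE (@comul_contr _ Rl) // (@comul_contl _ Ll) //.
rewrite (tmap_comp (h := Ll) (h' := Rl)) //.
apply: tmap_comp => y; apply: val_inj; rewrite !val_corner_proj.
  exact: sandwich_contl.
exact: sandwich_contr.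
Qed.

Lemma corner_counitE x : corner_counit (corner_proj x) = e (sandwich e x).
Proof. by []. Qed.

Lemma corner_comulA x :
  tassoc (tmap corner_comul idfun (corner_comul x))
  = tmap idfun corner_comul (corner_comul x).
Proof.
rewrite -[x]corner_projK; move: (subspace_incl _ x) => {}x.
rewrite corner_comulE.
pose h : {linear C -> tensor (subspace_type corner) (subspace_type corner)} :=
  GRing.Linear.clone _ _ _ _ (tmap corner_proj corner_proj \o comul) _.
rewrite (tmap_comp (h := h) (h' := corner_proj)) //; last exact: corner_comulE.
rewrite (tmap_comp (h := corner_proj) (h' := h)) //; last exact: corner_comulE.
rewrite -(tmap_comp (f := comul) (g := idfun)
           (f' := tmap corner_proj corner_proj) (g' := corner_proj)) //.
rewrite -(tmap_comp (f := idfun) (g := comul)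
           (f' := corner_proj) (g' := tmap corner_proj corner_proj)) //.
by rewrite tassoc_map comulA.
Qed.

Lemma corner_counitl x : contl corner_counit (corner_comul x) = x.
Proof.
rewrite -[x]corner_projK; move: (subspace_incl _ x) => {}x.
rewrite corner_comulE (contl_map2 (f := e)); last exact: idem_sandwich.
by apply: val_inj; rewrite !val_corner_proj sandwich_contl.
Qed.

Lemma corner_counitr x : contr corner_counit (corner_comul x) = x.
Proof.
rewrite -[x]corner_projK; move: (subspace_incl _ x) => {}x.
rewrite corner_comulE (contr_map2 (f := e)); last exact: idem_sandwich.
by apply: val_inj; rewrite !val_corner_proj sandwich_contr.
Qed.

Definition corner_coalgebra : coalgebra k :=
  Coalgebra corner_comulA corner_counitl corner_counitr.

Section CornerSubcoalgebra.
Variable D : subcoalgebra C.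

Definition corner_sub_set : set corner_coalgebra := corner_proj @` D.

Lemma corner_sub_subproof0 : corner_sub_set 0.
Proof. by exists 0; rewrite ?linear0 //; exact: subspace0. Qed.

Lemma corner_sub_subproof_linear (c : k) (x y : corner_coalgebra) :
  corner_sub_set x -> corner_sub_set y -> corner_sub_set (c *: x + y).
Proof.
move=> [u Du <-] [v Dv <-]; exists (c *: u + v); last exact: linearP.
exact: subspace_linear.
Qed.

Lemma corner_sub_subproof_comul (x : corner_coalgebra) :
  corner_sub_set x -> tsub corner_sub_set corner_sub_set (comul x).
Proof.
move=> [u /subcoalgP Du <-].
rewrite -[comul _]/(corner_comul (corner_proj u)) corner_comulE.
elim/tsub_ind: Du => [|v w Dv Dw|s t IHs IHt].
- by rewrite linear0; exact: tsub0.
- by rewrite tmapE; apply: tsub_tens; [exists v | exists w].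
- by rewrite linearD; apply: tsubD.
Qed.

Definition corner_subcoalgebra : subcoalgebra corner_coalgebra :=
  @Subcoalgebra k corner_coalgebra
    (Subspace corner_sub_subproof0 corner_sub_subproof_linear)
    corner_sub_subproof_comul.

End CornerSubcoalgebra.
End Corner.

Record quiver := Quiver {
  vertex : Type;
  arrow : Type;
  source : arrow -> vertex;
  target : arrow -> vertex
}.

Section Paths.
Variable G : quiver.

Fixpoint composable (a : vertex G) (s : seq (arrow G)) : Prop :=
  if s is x :: s' then source x = a /\ composable (target x) s' else True.

(** The starting vertex is recorded so that the paths of length [0] are the
    vertices; it is redundant for the other paths. *)
Record qpath := QPath {
  start : vertex G;
  arrows : seq (arrow G);
  qpathP : composable start arrows
}.

Definition path_length (p : qpath) : nat := size (arrows p).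

Definition vertex_path (a : vertex G) : qpath := @QPath a [::] I.

Lemma qpath_eq p q : start p = start q -> arrows p = arrows q -> p = q.
Proof.
case: p q => [a s sP] [b t tP] /= ab st; case: _ / ab tP; case: _ / st => tP.
by rewrite (Prop_irrelevance sP tP).
Qed.

Definition endpoint (a : vertex G) (s : seq (arrow G)) : vertex G :=
  last a (map (@target G) s).

Lemma composable_cat a s t :
  composable a (s ++ t) <-> composable a s /\ composable (endpoint a s) t.
Proof.
elim: s a => [|x s IHs] a /=; first by split=> // -[].
rewrite IHs -[endpoint a _]/(endpoint (target x) s).
by split=> [[? []]|[[]]].
Qed.

Lemma prefix_subproof i p : composable (start p) (take i (arrows p)).
Proof.
by have := qpathP p; rewrite -{1}(cat_take_drop i (arrows p)) composable_cat => -[].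
Qed.

Lemma suffix_subproof i p :
  composable (endpoint (start p) (take i (arrows p))) (drop i (arrows p)).
Proof.
by have := qpathP p; rewrite -{1}(cat_take_drop i (arrows p)) composable_cat => -[].
Qed.

Definition path_prefix i p : qpath := QPath (prefix_subproof i p).
Definition path_suffix i p : qpath := QPath (suffix_subproof i p).

Definition is_concat (p1 p2 p : qpath) : Prop :=
  [/\ start p1 = start p, endpoint (start p1) (arrows p1) = start p2
    & arrows p1 ++ arrows p2 = arrows p].

Lemma is_concatP p1 p2 p : is_concat p1 p2 p <->
  exists2 i, (i <= path_length p)%N &
    p1 = path_prefix i p /\ p2 = path_suffix i p.
Proof.
split=> [[s1 s2 s12]|[i ip [-> ->]]]; last by split=> //=; rewrite cat_take_drop.
exists (path_length p1); first by rewrite /path_length -s12 size_cat leq_addr.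
by split; apply: qpath_eq; rewrite //= -s12 ?take_size_cat ?drop_size_cat // -s1.
Qed.

End Paths.

Section PathCoalgebra.
Variables (k : fieldType) (G : quiver).

Definition path_space : lmodType k :=
  GRing.Lmodule.clone k {freeg {classic qpath G} / k} _.

Definition path_basis (p : qpath G) : path_space :=
  fgen k (p : {classic qpath G}).

Lemma path_space_ind (P : path_space -> Prop) :
    P 0 -> (forall c p x, P x -> P (c *: path_basis p + x)) -> forall x, P x.
Proof. exact: (@freeg_ext_ind k {classic qpath G} P). Qed.

Definition path_lift (W : lmodType k) (f : qpath G -> W) :
    {linear path_space -> W} :=
  GRing.Linear.clone _ _ _ _ (fglift (f : {classic qpath G} -> W)) _.

Lemma path_liftE (W : lmodType k) (f : qpath G -> W) p :
  path_lift f (path_basis p) = f p.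
Proof. exact: fglift_gen. Qed.

(** By [is_concatP], the sum is over all ways of writing [p] as a
    concatenation. *)
Definition path_comul : {linear path_space -> tensor path_space path_space} :=
  path_lift (fun p => \sum_(i < (path_length p).+1)
    path_basis (path_prefix i p) ⊗ path_basis (path_suffix i p)).

Definition path_counit : {linear path_space -> k^o} :=
  path_lift (fun p => ((path_length p == 0%N)%:R : k^o)).

Lemma path_comulE p : path_comul (path_basis p) =
  \sum_(i < (path_length p).+1)
    path_basis (path_prefix i p) ⊗ path_basis (path_suffix i p).
Proof. exact: path_liftE. Qed.

Lemma path_comulA x :
  tassoc (tmap path_comul idfun (path_comul x))
  = tmap idfun path_comul (path_comul x).
Proof.
elim/path_space_ind: x => [|c p x IH]; first by rewrite !linear0.
rewrite !linearP IH; congr (_ *: _ + _); rewrite {x IH} path_comulE.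
set n := path_length p.
pose F (j i : nat) := path_basis (path_prefix j p) ⊗
  (path_basis (path_prefix (i - j) (path_suffix j p)) ⊗
   path_basis (path_suffix i p)).
transitivity (\sum_(i < n.+1) \sum_(j < n.+1 | (j <= i)%N) F j i).
  rewrite !linear_sum; apply: eq_bigr => i _.
  have len : path_length (path_prefix i p) = i.
    by rewrite /path_length size_takel // -ltnS.
  rewrite tmapE path_comulE len linear_sumlz linear_sum /=.
  rewrite (big_ord_widen_cond n.+1 xpredT (fun j => tassoc
    (path_basis (path_prefix j (path_prefix i p)) ⊗
     path_basis (path_suffix j (path_prefix i p)) ⊗
     path_basis (path_suffix i p)))) //.
  apply: eq_bigr => j /= ji; rewrite tassocE /F.
  congr (path_basis _ ⊗ (path_basis _ ⊗ _)); apply: qpath_eq => //=.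
  - by rewrite take_takel.
  - by rewrite take_takel.
  - by rewrite take_drop subnK.
rewrite (exchange_big_dep xpredT) //= !linear_sum; apply: eq_bigr => j _.
have jn : (j <= n)%N by rewrite -ltnS.
have len : path_length (path_suffix j p) = (n - j)%N.
  by rewrite /path_length size_drop.
rewrite tmapE path_comulE len linear_sumr /=.
rewrite -(big_mkord (fun i => (j <= i)%N) (F j)) (big_cat_nat _ (n := j)) //=.
  rewrite big_nat_cond big_pred0 ?add0r => [|i]; last first.
    by rewrite /=; case: ltnP => //=; rewrite andbF.
  rewrite -{1}[val j]add0n big_addn subSn // big_mkord.
  apply: eq_big => [i|i _]; first by rewrite leq_addl.
  rewrite /F addnK; congr (_ ⊗ (_ ⊗ path_basis _)); apply: qpath_eq => /=.
    by rewrite /endpoint -last_cat -map_cat addnC takeD.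
  by rewrite drop_drop.
exact: leqW.
Qed.

Lemma contl_path_comul (f : {linear path_space -> k^o}) p :
  (forall q, path_length q != 0%N -> f (path_basis q) = 0) ->
  contl f (path_comul (path_basis p))
  = (f (path_basis (vertex_path (start p))) : k) *: path_basis p.
Proof.
move=> f0; rewrite path_comulE big_ord_recl linearD /= linear_sum big1 => [|i _].
  rewrite addr0 contlE; congr ((f (path_basis _) : k) *: path_basis _);
  by apply: qpath_eq; rewrite /= ?take0 ?drop0.
rewrite contlE f0 ?scale0r // /path_length size_takel //.
Qed.

Lemma contr_path_comul (f : {linear path_space -> k^o}) p :
  (forall q, path_length q != 0%N -> f (path_basis q) = 0) ->
  contr f (path_comul (path_basis p))
  = (f (path_basis (vertex_path (endpoint (start p) (arrows p)))) : k)
    *: path_basis p.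
Proof.
move=> f0; rewrite path_comulE big_ord_recr linearD /= linear_sum big1 => [|i _].
  rewrite add0r contrE; congr ((f (path_basis _) : k) *: path_basis _);
  by apply: qpath_eq; rewrite /= ?take_size ?drop_size.
by rewrite contrE f0 ?scale0r // /path_length size_drop subn_eq0 -ltnNge /=.
Qed.

Lemma path_counitE p :
  path_counit (path_basis p) = (path_length p == 0%N)%:R.
Proof. exact: path_liftE. Qed.

Lemma path_counitl x : contl path_counit (path_comul x) = x.
Proof.
elim/path_space_ind: x => [|c p x IH]; first by rewrite !linear0.
rewrite !linearP IH contl_path_comul => [|q /negPf q0].
  by rewrite path_counitE scale1r.
by rewrite path_counitE q0.
Qed.

Lemma path_counitr x : contr path_counit (path_comul x) = x.
Proof.
elim/path_space_ind: x => [|c p x IH]; first by rewrite !linear0.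
rewrite !linearP IH contr_path_comul => [|q /negPf q0].
  by rewrite path_counitE scale1r.
by rewrite path_counitE q0.
Qed.

Definition path_coalgebra : coalgebra k :=
  Coalgebra path_comulA path_counitl path_counitr.

Definition char_fun (X : set (vertex G)) : {linear path_coalgebra -> k^o} :=
  path_lift (fun p =>
    (((path_length p == 0%N) && `[< X (start p) >])%:R : k^o)).

Lemma char_fun_idempotent X :
  convolution (char_fun X) (char_fun X) =1 char_fun X.
Proof.
have eE p : char_fun X (path_basis p)
    = ((path_length p == 0%N) && `[< X (start p) >])%:R.
  exact: path_liftE.
move=> x; rewrite -[LHS]/(contl (char_fun X)
  (tmap idfun (char_fun X) (path_comul x))) contl_map.
elim/path_space_ind: x => [|c p x IH]; first by rewrite !linear0.
rewrite !linearP IH contl_path_comul => [|q /negPf q0]; last by rewrite eE q0.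
congr (_ *: _ + _); rewrite linearZ !eE.
case: (path_length p == 0%N) => /=; last exact: scaler0.
by case: `[< _ >]; rewrite ?scale1r ?scale0r.
Qed.

Definition char_idempotent (X : set (vertex G)) :
    dual_idempotent path_coalgebra :=
  DualIdempotent (char_fun_idempotent X).

End PathCoalgebra.

(* Main.v *)
(* A coalgebra [C] is prime iff its dual algebra is: [f ∗ h ∗ g = 0] for all
   [h] forces [f = 0] or [g = 0].  One direction applies primeness of [C] to
   the largest subcoalgebras on which [f] and [g] vanish; for the other, a
   proper subcoalgebra is annihilated by a nonzero functional.  The same
   criterion holds for the corner at [e], with [f] and [g] ranging over
   [e ∗ C^* ∗ e], so primeness passes to corners.

   Conversely, let [f] and [g] be nonzero on [D].  Some components
   [f' = e_a ∗ f ∗ e_b] and [g' = e_c ∗ g ∗ e_d] are nonzero.  The corner at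
   [{a, b}] gives [u] with [f' ∗ u ∗ e_a] nonzero, the corner at [{c, d}] gives
   [v] with [e_d ∗ v ∗ g'] nonzero, and the corner at [{a, d}] joins these two. *)

Require Import Defs.
From HB Require Import structures.
From mathcomp Require Import all_boot all_algebra.
From mathcomp Require Import boolp classical_sets.

Set Implicit Arguments.
Unset Strict Implicit.
Unset Printing Implicit Defensive.

Import GRing.Theory.
Local Open Scope classical_set_scope.
Local Open Scope ring_scope.

(** Proof irrelevance identifies the linearity proofs, so identities in the dual algebra become
    equalities usable for rewriting. *)
Lemma linear_ext (k : fieldType) (U V : lmodType k) (f g : {linear U -> V}) :
  f =1 g -> f = g.
Proof.
case: f g => f [[fa] [fl]] [g [[ga] [gl]]] /= /funext fg.
case: _ / fg in ga gl *.
by rewrite (Prop_irrelevance fa ga) (Prop_irrelevance fl gl).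
Qed.

Section Functionals.
Variable k : fieldType.

(** * Separation of vectors and subspaces by linear functionals *)

Section Separation.
Variable V : lmodType k.

(** Retract onto the line spanned by [y] and take the coefficient of [y]; this is unique, hence
    linear, because [y] is nonzero. *)
Lemma linear_functional_neq0 (y : V) :
  y != 0 -> exists phi : {linear V -> k^o}, phi y != 0.
Proof.
move=> y0.
have line0 : [set c *: y | c in [set: k]] 0 by exists 0; rewrite ?scale0r.
have line_lin (c : k) (u v : V) : [set c *: y | c in [set: k]] u ->
    [set c *: y | c in [set: k]] v -> [set c *: y | c in [set: k]] (c *: u + v).
  move=> [a _ <-] [b _ <-]; exists (c * a + b) => //.
  by rewrite scalerDl scalerA.
pose S := Subspace line0 line_lin.
have /choice[phi phiE] : forall x, exists c : k,
    c *: y = subspace_incl S (subspace_retraction S x).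
  by move=> x; have [c _ cE] := subspace_valP (subspace_retraction S x); exists c.
have yI : injective (fun c : k => c *: y).
  move=> a b /eqP; rewrite -subr_eq0 -scalerBl scaler_eq0 (negPf y0) orbF subr_eq0.
  by move/eqP.
have phi_lin : linear (phi : V -> k^o).
  move=> c u v; apply: yI.
  by rewrite phiE !linearP -!phiE scalerDl scalerA.
pose phiL := GRing.isLinear.Build k V k^o *:%R phi phi_lin.
pose phi' : {linear V -> k^o} := HB.pack (phi : V -> k^o) phiL.
exists phi'; rewrite -[phi' y]/(phi y); apply/eqP => phiy.
have := phiE y; rewrite phiy scale0r subspace_retraction_in; last first.
  by exists 1; rewrite ?scale1r.
by move=> y0'; rewrite -y0' eqxx in y0.
Qed.

(** Its kernel is exactly [S], so this endomorphism stands in for the quotient map from [V] to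
    [V/S]. *)
Definition subspace_coretraction (S : subspace V) : {linear V -> V} :=
  GRing.Linear.clone _ _ _ _
    (idfun \- (subspace_incl S \o subspace_retraction S)) _.

Lemma subspace_coretractionE S x :
  subspace_coretraction S x = x - subspace_incl S (subspace_retraction S x).
Proof. by []. Qed.

Lemma subspace_coretraction0 (S : subspace V) x :
  sset S x -> subspace_coretraction S x = 0.
Proof. by move=> Sx; rewrite subspace_coretractionE subspace_retraction_in ?subrr. Qed.

Lemma subspace_coretraction_eq0 (S : subspace V) x :
  subspace_coretraction S x = 0 -> sset S x.
Proof.
rewrite subspace_coretractionE => /eqP; rewrite subr_eq0 => /eqP ->.
exact: subspace_valP.
Qed.

Lemma subspace_separation (S : subspace V) y : ~ sset S y ->
  exists phi : {linear V -> k^o}, (forall x, sset S x -> phi x = 0) /\ phi y != 0.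
Proof.
move=> Sy.
have [|phi phiy] := @linear_functional_neq0 (subspace_coretraction S y).
  by apply/eqP => /subspace_coretraction_eq0.
exists (GRing.Linear.clone _ _ _ _ (phi \o subspace_coretraction S) _).
split=> // x Sx; rewrite -[LHS]/(phi (subspace_coretraction S x)).
by rewrite subspace_coretraction0 ?linear0.
Qed.

Lemma linear_functional_eq0 (y : V) :
  (forall phi : {linear V -> k^o}, phi y = 0) -> y = 0.
Proof.
move=> Hy; apply: contrapT => /eqP/linear_functional_neq0[phi].
by rewrite Hy eqxx.
Qed.

End Separation.

(** * Tensors detected by pairs of functionals *)

Section TensorSeparation.
Variables U V : lmodType k.

Lemma tensor_seq (t : tensor U V) :
  exists s : seq (U * V), t = \sum_(p <- s) p.1 ⊗ p.2.
Proof.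
elim/tensor_ind: t => [|u v|_ _ [s ->] [t ->]].
- by exists [::]; rewrite big_nil.
- by exists [:: (u, v)]; rewrite big_seq1.
- by exists (s ++ t); rewrite big_cat.
Qed.

Lemma span_separation (s : seq U) (u : U) :
  (exists c : nat -> k, u = \sum_(i < size s) c i *: s`_i) \/
  exists phi : {linear U -> k^o}, (forall x, x \in s -> phi x = 0) /\ phi u != 0.
Proof.
pose S0 := [set x | exists c : nat -> k, x = \sum_(i < size s) c i *: s`_i].
have S00 : S0 0.
  by exists (fun=> 0); rewrite big1 // => i _; rewrite scale0r.
have S0lin (c : k) (x y : U) : S0 x -> S0 y -> S0 (c *: x + y).
  move=> [a ->] [b ->]; exists (fun i => c * a i + b i).
  rewrite scaler_sumr -big_split; apply: eq_bigr => i _ /=.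
  by rewrite scalerDl scalerA.
have [|nSu] := EM (S0 u); [by left | right].
have [phi [phiS phiu]] := @subspace_separation _ (Subspace S00 S0lin) u nSu.
exists phi; split=> // _ /(nthP 0)[i ilt <-]; apply: phiS.
exists (fun j => (j == i)%:R); rewrite (bigD1 (Ordinal ilt)) //= eqxx scale1r.
by rewrite big1 ?addr0 // => j /negPf ji; rewrite (ji : (j == i :> nat) = _) scale0r.
Qed.

(** Induction on the length of a representation, whose first term is either absorbed by the others
    or forced to vanish. *)
Lemma tensor_contl_eq0 (t : tensor U V) :
  (forall phi : {linear U -> k^o}, contl phi t = 0) -> t = 0.
Proof.
have [s ->] := tensor_seq t; have [n] := ubnP (size s).
elim: n => // n IHn in s *; case: s => [|[u v] s] /=; first by rewrite big_nil.
rewrite ltnS => sn; rewrite big_cons /=.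
have [[c ->]|[phi [phis phiu]]] := span_separation (map fst s) u.
  (* The linear relation for [u] distributes [v] over the right factors of the other terms. *)
  pose s' := [seq ((s`_i).1, (s`_i).2 + c i *: v) | i <- index_iota 0 (size s)].
  have -> : (\sum_(i < size (map fst s)) c i *: (map fst s)`_i) ⊗ v
      + \sum_(p <- s) p.1 ⊗ p.2 = \sum_(p <- s') p.1 ⊗ p.2.
    rewrite linear_sumlz size_map (big_nth 0) big_map !big_mkord.
    rewrite -big_split; apply: eq_bigr => i _ /=.
    rewrite (nth_map 0) // linearDr [RHS]addrC; congr (_ + _).
    by rewrite linearZl_LR linearZr_LR.
  by apply: IHn; rewrite size_map size_iota subn0.
(* [phi] kills all left factors but [u], so [v] is zero. *)
move=> Ht; have := Ht phi; rewrite linearD linear_sum big1_seq ?addr0 => [|p /= ps].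
  rewrite contlE => /eqP; rewrite scaler_eq0 (negPf phiu) /= => /eqP v0.
  move: Ht; rewrite v0 linear0r add0r; exact: IHn.
by rewrite contlE phis ?scale0r //; apply: map_f.
Qed.

(** The functional [f ⊗ g], with k ⊗ k identified with k. *)
Definition pairing (f : {linear U -> k^o}) (g : {linear V -> k^o})
  (t : tensor U V) : k^o := contl f (tmap idfun g t).

Lemma pairing_tens f g u v : pairing f g (u ⊗ v) = (f u : k) * g v.
Proof. by rewrite /pairing tmapE contlE. Qed.

Lemma pairing0 f g : pairing f g 0 = 0.
Proof. by rewrite /pairing !linear0. Qed.

Lemma pairingD f g s t : pairing f g (s + t) = pairing f g s + pairing f g t.
Proof. by rewrite /pairing !linearD. Qed.

Lemma pairing_contl f g t : pairing f g t = g (contl f t).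
Proof. exact: contl_map. Qed.

Lemma pairing_contr f g t : pairing f g t = f (contr g t).
Proof.
elim/tensor_ind: t => [|u v|s t IHs IHt]; first by rewrite pairing0 !linear0.
  by rewrite pairing_tens contrE linearZ; exact: mulrC.
by rewrite pairingD !linearD IHs IHt.
Qed.

Lemma tensor_pairing_eq0 (t : tensor U V) :
  (forall f g, pairing f g t = 0) -> t = 0.
Proof.
move=> H; apply: tensor_contl_eq0 => f; apply: linear_functional_eq0 => g.
by rewrite -pairing_contl.
Qed.

End TensorSeparation.

Lemma pairing_tmap (U V U' V' : lmodType k) (i : {linear U -> U'})
    (j : {linear V -> V'}) (f : {linear U -> k^o}) (g : {linear V -> k^o})
    (f' : {linear U' -> k^o}) (g' : {linear V' -> k^o}) t :
  (forall u, f' (i u) = f u) -> (forall v, g' (j v) = g v) ->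
  pairing f' g' (tmap i j t) = pairing f g t.
Proof.
move=> ff gg; elim/tensor_ind: t => [|u v|s t IHs IHt].
- by rewrite linear0 !pairing0.
- by rewrite tmapE !pairing_tens ff gg.
- by rewrite linearD !pairingD IHs IHt.
Qed.

(** With q the two coretractions, u ⊗ v = qu ⊗ (v - qv) + (u - qu) ⊗ v + qu ⊗ qv. The last term is
    the only obstruction to lying in U ⊗ B + A ⊗ V. *)
Lemma tmap_id_split (U V : lmodType k) (A : subspace U) (B : subspace V) t :
  exists s1 s2, [/\ tsub [set: U] B s1, tsub A [set: V] s2 &
    t = s1 + s2 + tmap (subspace_coretraction A) (subspace_coretraction B) t].
Proof.
elim/tensor_ind: t => [|u v|s t [s1 [s2 [Ps1 Ps2 sE]]] [t1 [t2 [Pt1 Pt2 tE]]]].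
- by exists 0, 0; split; rewrite ?linear0 ?addr0 //; exact: tsub0.
- pose qA := subspace_coretraction A; pose qB := subspace_coretraction B.
  exists (qA u ⊗ (v - qB v)), ((u - qA u) ⊗ v); split.
  + by apply: tsub_tens => //; rewrite /qB /= subKr; exact: subspace_valP.
  + by apply: tsub_tens => //; rewrite /qA /= subKr; exact: subspace_valP.
  + by rewrite tmapE addrAC -linearDr subrK -linearDl addrC subrK.
- exists (s1 + t1), (s2 + t2); split; [exact: tsubD | exact: tsubD |].
  by rewrite {1}sE {1}tE linearD addrACA (addrACA s1).
Qed.

(** The hypotheses say dually that [t] lies in A ⊗ V and in U ⊗ B, whose intersection is A ⊗ B. *)
Lemma tsub_left_right (U V : lmodType k) (A : subspace U) (B : subspace V) t :
  (forall (f : {linear U -> k^o}) (g : {linear V -> k^o}),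
     (forall x, sset A x -> f x = 0) -> pairing f g t = 0) ->
  (forall (f : {linear U -> k^o}) (g : {linear V -> k^o}),
     (forall x, sset B x -> g x = 0) -> pairing f g t = 0) ->
  tsub A B t.
Proof.
move=> HA HB.
pose pA : {linear U -> U} := GRing.Linear.clone _ _ _ _ (subspace_incl A \o subspace_retraction A) _.
pose pB : {linear V -> V} := GRing.Linear.clone _ _ _ _ (subspace_incl B \o subspace_retraction B) _.
suff -> : t = tmap pA pB t.
  elim/tensor_ind: t {HA HB} => [|u v|s t IHs IHt].
  - by rewrite linear0; exact: tsub0.
  - by rewrite tmapE; apply: tsub_tens; exact: subspace_valP.
  - by rewrite linearD; exact: tsubD.
apply/eqP; rewrite -subr_eq0; apply/eqP; apply: tensor_pairing_eq0 => f g.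
pose fA : {linear U -> k^o} := GRing.Linear.clone _ _ _ _ (f \o subspace_coretraction A) _.
pose gB : {linear V -> k^o} := GRing.Linear.clone _ _ _ _ (g \o subspace_coretraction B) _.
pose fp : {linear U -> k^o} := GRing.Linear.clone _ _ _ _ (f \o pA) _.
(* With p the projections [pA], [pB] and q = 1 - p, this is 1 ⊗ 1 - p ⊗ p = q ⊗ 1 + p ⊗ q. *)
have -> : pairing f g (t - tmap pA pB t) = pairing fA g t + pairing fp gB t.
  elim/tensor_ind: t {HA HB} => [|u v|s t IHs IHt].
  - by rewrite linear0 subr0 !pairing0 addr0.
  - rewrite tmapE /pairing !linearB /= -!/(pairing _ _ _) !pairing_tens /= !linearB /=.
    rewrite mulrBl mulrBr.
    by rewrite addrA subrK.
  - by rewrite linearD opprD addrACA [LHS]pairingD IHs IHt !pairingD addrACA.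
rewrite HA ?HB ?addr0 // => x Sx.
  by rewrite -[LHS]/(g (subspace_coretraction B x)) subspace_coretraction0 ?linear0.
by rewrite -[LHS]/(f (subspace_coretraction A x)) subspace_coretraction0 ?linear0.
Qed.

(** * The dual algebra and primeness *)

Section Convolution.
Variable C : coalgebra k.
Local Notation dual := {linear C -> k^o}.
Implicit Types f g h : dual.

Local Notation "f ∗ g" := (convolution f g) (at level 40, left associativity).

Lemma convolutionE f g x : (f ∗ g) x = pairing f g (comul x).
Proof. by []. Qed.

Lemma convolution_contl f g x : (f ∗ g) x = g (contl f (comul x)).
Proof. exact: pairing_contl. Qed.

Lemma convolution_contr f g x : (f ∗ g) x = f (contr g (comul x)).
Proof. exact: pairing_contr. Qed.

Lemma convolutionA f g h : f ∗ (g ∗ h) = f ∗ g ∗ h.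
Proof.
apply: linear_ext => x; rewrite [LHS]convolution_contl [RHS]convolution_contr.
rewrite [LHS]convolution_contr [RHS]convolution_contl; congr (g _).
by rewrite -contr_map -contl_map contlr_assoc comulA.
Qed.

(* [convolution] is generalized because unification would otherwise unfold it,
   at a cost exponential in the number of factors. *)
Lemma convolution_regroup (p q r s t u v f g : dual) :
  p ∗ f ∗ q ∗ r ∗ s ∗ (t ∗ (u ∗ g ∗ v))
  = p ∗ (f ∗ (q ∗ r ∗ s ∗ t ∗ u) ∗ g ∗ v).
Proof.
by move: (@convolution k C) convolutionA => conv convA; rewrite !convA.
Qed.

Lemma convolution_unitl f : counit ∗ f = f.
Proof. by apply: linear_ext => x; rewrite convolution_contl counitl. Qed.

Lemma convolution_unitr f : f ∗ counit = f.
Proof. by apply: linear_ext => x; rewrite convolution_contr counitr. Qed.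

Lemma idempotentE (e : dual_idempotent C) : (e : dual) ∗ e = e.
Proof. exact/linear_ext/idemP. Qed.

(** Thus [sandwich e] is dual to the map sending [f] to [e ∗ f ∗ e]. *)
Lemma sandwich_convolution (e : dual_idempotent C) f x :
  f (sandwich e x) = (e ∗ f ∗ e) x.
Proof.
by rewrite -convolutionA sandwichE -convolution_contr -convolution_contl.
Qed.

(** As [comul] maps [D] into D ⊗ D, the annihilator of [D] is a two-sided ideal of the dual algebra;
    this is its stability under right multiplication. *)
Lemma convolution_vanishl (D : subcoalgebra C) f g :
  (forall x, sset D x -> f x = 0) -> forall x, sset D x -> (f ∗ g) x = 0.
Proof.
move=> fD x /subcoalgP; rewrite convolutionE.
elim/tsub_ind => [|u v Du Dv|s t IHs IHt]; first exact: pairing0.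
  by rewrite pairing_tens fD ?mul0r.
by rewrite pairingD IHs IHt addr0.
Qed.

Lemma convolution_vanishr (D : subcoalgebra C) f g :
  (forall x, sset D x -> g x = 0) -> forall x, sset D x -> (f ∗ g) x = 0.
Proof.
move=> gD x /subcoalgP; rewrite convolutionE.
elim/tsub_ind => [|u v Du Dv|s t IHs IHt]; first exact: pairing0.
  by rewrite pairing_tens gD ?mulr0.
by rewrite pairingD IHs IHt addr0.
Qed.

Section LargestSubcoalgebra.
Variable f : dual.

(** The orthogonal in [C] of the two-sided ideal generated by [f]; it contains every subcoalgebra on
    which [f] vanishes. *)
Definition orthogonal_ideal : set C := [set x | forall u v, (u ∗ f ∗ v) x = 0].

Lemma orthogonal_ideal0 : orthogonal_ideal 0.
Proof. by move=> u v; rewrite linear0. Qed.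

Lemma orthogonal_ideal_linear (c : k) (x y : C) :
  orthogonal_ideal x -> orthogonal_ideal y -> orthogonal_ideal (c *: x + y).
Proof. by move=> Ax Ay u v; rewrite linearP Ax Ay scaler0 addr0. Qed.

Definition orthogonal_subspace : subspace C :=
  Subspace orthogonal_ideal0 orthogonal_ideal_linear.

(** Contracting either factor of [comul x] against a functional stays in the orthogonal: the
    functional is absorbed into [u] or [v]. *)
Lemma orthogonal_ideal_comul x : orthogonal_ideal x ->
  tsub orthogonal_subspace orthogonal_subspace (comul x).
Proof.
move=> Ax; apply: tsub_left_right => g h gA.
  rewrite pairing_contr; apply: gA => u v.
  by rewrite -convolution_contr -convolutionA; exact: Ax.
rewrite pairing_contl; apply: gA => u v.
by rewrite -convolution_contl !convolutionA; exact: Ax.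
Qed.

Definition largest_subcoalgebra : subcoalgebra C :=
  @Subcoalgebra k C orthogonal_subspace orthogonal_ideal_comul.

Lemma largest_subcoalgebra_ker x : sset largest_subcoalgebra x -> f x = 0.
Proof.
by move=> /(_ counit counit); rewrite convolution_unitl convolution_unitr.
Qed.

End LargestSubcoalgebra.

Definition dual_prime (D : set C) : Prop := forall f g,
  (forall h x, D x -> (f ∗ h ∗ g) x = 0) ->
  (forall x, D x -> f x = 0) \/ (forall x, D x -> g x = 0).

(** The remainder left by [tmap_id_split] pairs with [f] and [g] as [comul x] does with functionals
    vanishing on [A] and [B]. *)
Lemma wedge_annihilator (A B : subspace C) x :
  (forall f g, (forall y, sset A y -> f y = 0) ->
     (forall y, sset B y -> g y = 0) -> (f ∗ g) x = 0) ->
  wedge (A : set C) B x.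
Proof.
move=> AB; have [s [t [Bs At xE]]] := tmap_id_split A B (comul x).
exists s, t; split=> //; rewrite xE [X in _ + X](_ : _ = 0) ?addr0 //.
apply: tensor_pairing_eq0 => f g.
pose fA : dual := GRing.Linear.clone _ _ _ _ (f \o subspace_coretraction A) _.
pose gB : dual := GRing.Linear.clone _ _ _ _ (g \o subspace_coretraction B) _.
rewrite (pairing_tmap (f := fA) (g := gB)) //; apply: AB => y Sy.
  by rewrite -[LHS]/(f (subspace_coretraction A y)) subspace_coretraction0 ?linear0.
by rewrite -[LHS]/(g (subspace_coretraction B y)) subspace_coretraction0 ?linear0.
Qed.

Lemma prime_coalgebraP : prime_coalgebra C <-> dual_prime [set: C].
Proof.
split=> [Cprime f g fg|Cprime A B CAB].
  have [|fT|gT] := Cprime (largest_subcoalgebra f) (largest_subcoalgebra g).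
  - apply/seteqP; split=> // x _; apply: wedge_annihilator => f' g' f'A g'B.
    rewrite convolution_contr; apply: f'A => u v; rewrite -convolution_contr.
    rewrite convolution_contl; apply: g'B => u' v'; rewrite -convolution_contl.
    (* The hypothesis [fg] applies with middle factor [v ∗ u']; the outer factors are contracted
       into the argument. *)
    have -> : u ∗ f ∗ v ∗ (u' ∗ g ∗ v') = u ∗ (f ∗ (v ∗ u') ∗ g) ∗ v'.
      by rewrite !convolutionA.
    rewrite convolution_contr convolution_contl; exact: fg.
  - by left=> x _; apply: largest_subcoalgebra_ker; rewrite -fT.
  - by right=> x _; apply: largest_subcoalgebra_ker; rewrite -gT.
have [AT|nA] := EM (forall x, sset A x).
  by left; apply/seteqP; split=> // x _; exact: AT.
have [BT|nB] := EM (forall x, sset B x).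
  by right; apply/seteqP; split=> // x _; exact: BT.
have /existsNP[x /subspace_separation[f [fA fx]]] := nA.
have /existsNP[y /subspace_separation[g [gB gy]]] := nB.
have [h z _| f0 | g0] := Cprime f g.
(* On C ⊗ B the factor [h ∗ g] vanishes, since the annihilator of [B] is an ideal; on A ⊗ C the
   factor [f] does. *)
- have : [set: C] z by []. rewrite CAB => -[s [t [Bs At zE]]].
  rewrite -convolutionA convolutionE zE pairingD.
  have -> : pairing f (h ∗ g) s = 0.
    elim/tsub_ind: Bs => [|u v _ Bv|s' t' IHs IHt]; first exact: pairing0.
      by rewrite pairing_tens (convolution_vanishr _ gB) ?mulr0.
    by rewrite pairingD IHs IHt addr0.
  rewrite add0r; elim/tsub_ind: At => [|u v Au _|s' t' IHs IHt].
  + exact: pairing0.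
  + by rewrite pairing_tens fA ?mul0r.
  + by rewrite pairingD IHs IHt addr0.
- by rewrite f0 ?eqxx in fx.
- by rewrite g0 ?eqxx in gy.
Qed.

End Convolution.

Local Notation "f ∗ g" := (convolution f g) (at level 40, left associativity).

(** * Transfer of the criterion to subcoalgebras and corners *)

Lemma convolution_incl (C : coalgebra k) (D : subcoalgebra C)
    (f g : {linear C -> k^o})
    (f' g' : {linear subcoalgebra_coalgebra D -> k^o}) x :
  (forall y, f (subspace_incl D y) = f' y) ->
  (forall y, g (subspace_incl D y) = g' y) ->
  (f ∗ g) (subspace_incl D x) = (f' ∗ g') x.
Proof.
move=> ff gg; rewrite !convolutionE -subcoalg_comulE.
exact: pairing_tmap.
Qed.

(** Restriction to [D] is an algebra map, and it is onto because functionals on [D] extend along a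
    retraction. *)
Lemma prime_subcoalgebraP (C : coalgebra k) (D : subcoalgebra C) :
  prime_coalgebra (subcoalgebra_coalgebra D) <-> dual_prime (D : set C).
Proof.
pose res (f : {linear C -> k^o}) : {linear subcoalgebra_coalgebra D -> k^o} :=
  GRing.Linear.clone _ _ _ _ (f \o subspace_incl D) _.
pose ext (f : {linear subcoalgebra_coalgebra D -> k^o}) : {linear C -> k^o} :=
  GRing.Linear.clone _ _ _ _ (f \o subspace_retraction D) _.
have extE f y : ext f (subspace_incl D y) = f y.
  by rewrite -[LHS]/(f (subspace_retraction D _)) subspace_retractionK.
rewrite prime_coalgebraP; split=> Dprime f g fg.
  have [h x _|f0|g0] := Dprime (res f) (res g).
  - rewrite -(convolution_incl (f := f ∗ ext h) (g := g)) // => [|y].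
      by apply: fg; exact: subspace_valP.
    exact: convolution_incl.
  - by left=> x Dx; exact: (f0 (subspace_elt Dx)).
  - by right=> x Dx; exact: (g0 (subspace_elt Dx)).
have [h x Dx|f0|g0] := Dprime (ext f) (ext g).
- rewrite -[x]/(subspace_incl D (subspace_elt Dx)).
  rewrite (convolution_incl (f' := f ∗ res h) (g' := g)) // => [|y]; first exact: fg.
  exact: convolution_incl.
- by left=> x _; rewrite -extE; apply: f0; exact: subspace_valP.
- by right=> x _; rewrite -extE; apply: g0; exact: subspace_valP.
Qed.

(** Pullback along [corner_proj] is multiplicative by [corner_comulE]; it identifies the dual of the
    corner with the functionals fixed by [e] on both sides. *)
Lemma convolution_corner_proj (C : coalgebra k) (e : dual_idempotent C)
    (f g : {linear corner_coalgebra e -> k^o}) (f' g' : {linear C -> k^o}) x :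
  (forall y, f (corner_proj e y) = f' y) ->
  (forall y, g (corner_proj e y) = g' y) ->
  (f ∗ g) (corner_proj e x) = (f' ∗ g') x.
Proof.
move=> ff gg; rewrite !convolutionE -[comul _]/(corner_comul e _) corner_comulE.
exact: pairing_tmap.
Qed.

Lemma prime_cornerP (C : coalgebra k) (e : dual_idempotent C)
    (D : subcoalgebra C) :
  prime_coalgebra (subcoalgebra_coalgebra (corner_subcoalgebra e D)) <->
  (forall f g : {linear C -> k^o},
     e ∗ f = f -> f ∗ e = f -> e ∗ g = g -> g ∗ e = g ->
     (forall h x, sset D x -> (f ∗ h ∗ g) x = 0) ->
     (forall x, sset D x -> f x = 0) \/ (forall x, sset D x -> g x = 0)).
Proof.
pose res (f : {linear C -> k^o}) : {linear corner_coalgebra e -> k^o} :=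
  GRing.Linear.clone _ _ _ _ (f \o subspace_incl (corner e)) _.
pose ext (f : {linear corner_coalgebra e -> k^o}) : {linear C -> k^o} :=
  GRing.Linear.clone _ _ _ _ (f \o corner_proj e) _.
have resE f y : res f (corner_proj e y) = (e ∗ f ∗ e) y.
  exact: sandwich_convolution.
have ext_sandwich f : e ∗ ext f ∗ e = ext f.
  apply: linear_ext => x; rewrite -sandwich_convolution.
  by congr (f _); apply: val_inj; exact: sandwich_idem.
have ee := idempotentE e.
rewrite prime_subcoalgebraP; split=> [Dprime f g ef fe eg ge fg|Dprime f g fg].
  have [h _ [x Dx <-]|f0|g0] := Dprime (res f) (res g).
  - rewrite (convolution_corner_proj (f' := f ∗ ext h) (g' := g)) => [|y|y].
    + exact: fg.
    + by apply: convolution_corner_proj => // z; rewrite resE ef fe.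
    + by rewrite resE eg ge.
  - by left=> x Dx; rewrite -fe -ef -resE; apply: f0; exists x.
  - by right=> x Dx; rewrite -ge -eg -resE; apply: g0; exists x.
have extl f' : e ∗ ext f' = ext f'.
  by rewrite -[in LHS]ext_sandwich !convolutionA ee ext_sandwich.
have extr f' : ext f' ∗ e = ext f'.
  by rewrite -[in LHS]ext_sandwich -!convolutionA ee !convolutionA ext_sandwich.
have [||||h x Dx|f0|g0] := Dprime (ext f) (ext g); rewrite ?extl ?extr //.
(* As [e] fixes both neighbours, [h] may be replaced by [e ∗ h ∗ e], the pullback of [res h]. *)
- rewrite -[ext f]extr -[ext g]extl.
  have -> : ext f ∗ e ∗ h ∗ (e ∗ ext g) = ext f ∗ (e ∗ h ∗ e) ∗ ext g.
    by rewrite !convolutionA.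
  rewrite -(convolution_corner_proj (f := f ∗ res h) (g := g)) //.
    by apply: fg; exists x.
  by move=> y; apply: convolution_corner_proj.
- by left=> _ [x Dx <-]; exact: f0.
- by right=> _ [x Dx <-]; exact: g0.
Qed.

End Functionals.

(** * Functionals on the path coalgebra and vertex idempotents *)

Section PathFunctionals.
Variables (k : fieldType) (G : quiver).

Local Notation C := (path_coalgebra k G).
Local Notation dual := {linear C -> k^o}.
Local Notation E X := (char_fun k X : dual).
Local Notation "f ∗ g" := (convolution f g) (at level 40, left associativity).

Definition path_end (p : qpath G) : vertex G := endpoint (start p) (arrows p).

Lemma char_fun_basis X p : E X (path_basis k p)
  = ((path_length p == 0%N) && `[< X (start p) >])%:R.
Proof. exact: path_liftE. Qed.

Lemma char_fun_vertex X v : E X (path_basis k (vertex_path v)) = `[< X v >]%:R.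
Proof. exact: char_fun_basis. Qed.

(** Only the factorization of [p] with first factor the vertex [start p] survives, [E X] being zero
    on paths of positive length. *)
Lemma convolution_charl X (f : dual) p :
  (E X ∗ f) (path_basis k p) = `[< X (start p) >]%:R * (f (path_basis k p) : k).
Proof.
rewrite convolution_contl contl_path_comul => [|q /negPf q0].
  by rewrite char_fun_vertex linearZ.
by rewrite char_fun_basis q0.
Qed.

Lemma convolution_charr X (f : dual) p :
  (f ∗ E X) (path_basis k p) = `[< X (path_end p) >]%:R * (f (path_basis k p) : k).
Proof.
rewrite convolution_contr contr_path_comul => [|q /negPf q0].
  by rewrite char_fun_vertex linearZ.
by rewrite char_fun_basis q0.
Qed.

Lemma path_functional_ext (f g : dual) :
  (forall p, f (path_basis k p) = g (path_basis k p)) -> f = g.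
Proof.
move=> fg; apply: linear_ext; elim/path_space_ind => [|c p x IH].
  by rewrite !linear0.
by rewrite !linearP fg IH.
Qed.

Lemma convolution_char (X Y : set (vertex G)) : E X ∗ E Y = E (X `&` Y).
Proof.
apply: path_functional_ext => p; rewrite convolution_charl !char_fun_basis.
by rewrite asbool_and andbCA -natrM mulnb.
Qed.

(* The alternatives are [F X = f ∗ E X] with [v = path_end] and [F X = E X ∗ f]
   with [v = start]; every element involves finitely many paths only. *)
Lemma vanish_components (D : set C) (f : dual) (v : qpath G -> vertex G)
    (F : set (vertex G) -> dual) :
  (forall X p, F X (path_basis k p)
     = `[< X (v p) >]%:R * (f (path_basis k p) : k)) ->
  (forall a x, D x -> F [set a] x = 0) -> forall x, D x -> f x = 0.
Proof.
move=> FE F0 x Dx.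
pose fin (s : seq {classic vertex G}) : set (vertex G) := [set` s].
(* [s] collects [v p] for the paths [p] in [x]. Allowing all [X] containing it lets the induction
   enlarge [s]. *)
have [s /(_ (fin s)) <- //] : exists s, forall X : set (vertex G),
    fin s `<=` X -> F X x = f x.
  elim/path_space_ind: x {Dx} => [|c p x [s IH]].
    by exists [::] => X _; rewrite !linear0.
  exists ((v p : {classic vertex G}) :: s) => X sX; rewrite !linearP FE IH.
    by rewrite asboolT ?mul1r //; apply: sX; rewrite /fin /= mem_head.
  by move=> a sa; apply: sX; rewrite /fin /= inE (sa : is_true _) orbT.
elim: s => [|a s IHs].
  suff FN y : F (fin [::]) y = 0 by exact: FN.
  elim/path_space_ind: y => [|c p y IH]; first by rewrite linear0.
  by rewrite linearP FE IH asboolF // mul0r scaler0 addr0.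
have [sa|nsa] := boolP (a \in s).
  rewrite [X in F X](_ : _ = fin s) //; apply/seteqP; split=> b; rewrite /fin /= inE.
    by case/predU1P => [->|].
  by move=> ->; rewrite orbT.
(* For [a] outside [s], the value of [F] at the disjoint union is the sum of its values at the two
   pieces, as is checked on paths. *)
rewrite -[RHS](addr0 0) -[X in X + _](F0 a x Dx) -[X in _ + X]IHs {IHs Dx}.
elim/path_space_ind: x => [|c p y IH]; first by rewrite !linear0 addr0.
rewrite !linearP IH !FE addrACA -scalerDr -mulrDl; congr (_ *: (_ * _) + _).
rewrite -natrD; congr (_%:R); rewrite /fin /= !asboolb inE.
have [->|av] := eqVneq (v p : {classic vertex G}) a.
  by rewrite (negPf nsa) asboolT.
by rewrite asboolF //= => va; case/eqP: av.
Qed.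

(** * From prime corners to primeness of [D] *)

Section Prime.
Variable D : subcoalgebra C.

Definition nonzero_on (f : dual) := ~ forall x, sset D x -> f x = 0.

(** The Peirce component at [a], [b]: such an [f] is zero on every path not running from [a] to
    [b]. *)
Definition component (a b : vertex G) (f : dual) : Prop :=
  E [set a] ∗ f = f /\ f ∗ E [set b] = f.

(** [vanish_components] is used twice, to cut first by end vertex and then by start vertex. *)
Lemma component_exists (f : dual) : nonzero_on f ->
  exists a b, nonzero_on (E [set a] ∗ f ∗ E [set b]).
Proof.
move=> f0; apply: contrapT => nE; apply: f0.
apply: (vanish_components (v := @path_end) (F := fun X => f ∗ E X)).
  by move=> X p; exact: convolution_charr.
move=> b; apply: (vanish_components (v := @start G)
    (F := fun X => E X ∗ (f ∗ E [set b]))).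
  by move=> X p; exact: convolution_charl.
move=> a x Dx; apply: contrapT => nx; apply: nE; exists a, b => /(_ x Dx).
by rewrite -convolutionA.
Qed.

Lemma component_charl (X : set (vertex G)) a b f :
  X a -> component a b f -> E X ∗ f = f.
Proof.
move=> Xa [af _]; rewrite -af convolutionA convolution_char.
by congr (E _ ∗ _); apply/seteqP; split=> [c [] //|c ->].
Qed.

Lemma component_charr (X : set (vertex G)) a b f :
  X b -> component a b f -> f ∗ E X = f.
Proof.
move=> Xb [_ fb]; rewrite -fb -convolutionA convolution_char.
by congr (_ ∗ E _); apply/seteqP; split=> [c [] //|c ->].
Qed.

Lemma component_sandwich a b f : component a b (E [set a] ∗ f ∗ E [set b]).
Proof.
split; first by rewrite !convolutionA convolution_char setIid.
by rewrite -convolutionA convolution_char setIid.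
Qed.

Hypothesis corners_prime : forall a b : vertex G,
  prime_coalgebra (subcoalgebra_coalgebra
    (corner_subcoalgebra (char_idempotent k [set a; b]) D)).

Lemma component_prime a b a1 b1 a2 b2 f g :
  [set a; b] a1 -> [set a; b] b1 -> [set a; b] a2 -> [set a; b] b2 ->
  component a1 b1 f -> component a2 b2 g -> nonzero_on f -> nonzero_on g ->
  exists h, nonzero_on (f ∗ h ∗ g).
Proof.
move=> Xa1 Xb1 Xa2 Xb2 fc gc f0 g0; apply: contrapT => nh.
have /prime_cornerP ab_prime := @corners_prime a b.
have [||||h|//|//] := ab_prime f g.
- exact: component_charl fc.
- exact: component_charr fc.
- exact: component_charl gc.
- exact: component_charr gc.
- by apply: contrapT => h0; apply: nh; exists h.
Qed.

(** A corner sees two vertices, while a product of two components may involve four. Turning [f] into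
    a loop at [a] removes [b]. *)
Lemma component_loopr a b f : component a b f -> nonzero_on f ->
  exists u, component a a (f ∗ u) /\ nonzero_on (f ∗ u).
Proof.
move=> fc f0.
have [h fhf] : exists h, nonzero_on (f ∗ h ∗ f).
  by apply: (@component_prime a b a b a b) => //; (by left) || (by right).
case: fc => af _; exists (h ∗ E [set a]); split; first split.
- by rewrite convolutionA af.
- by rewrite -!convolutionA convolution_char setIid.
(* Since [f] absorbs [E [set a]] on its left, [f ∗ h ∗ f] is a right multiple of [f ∗ (h ∗ E
   [set a])] and would vanish with it. *)
- move=> fu0; apply: fhf; rewrite -[X in _ ∗ X]af !convolutionA.
  by apply: convolution_vanishl; rewrite -convolutionA.
Qed.

(** The mirror image of [component_loopr], keeping the end vertex. *)
Lemma component_loopl a b f : component a b f -> nonzero_on f ->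
  exists u, component b b (u ∗ f) /\ nonzero_on (u ∗ f).
Proof.
move=> fc f0.
have [h fhf] : exists h, nonzero_on (f ∗ h ∗ f).
  by apply: (@component_prime a b a b a b) => //; (by left) || (by right).
case: fc => _ fb; exists (E [set b] ∗ h); split; first split.
- by rewrite !convolutionA convolution_char setIid.
- by rewrite -!convolutionA fb.
- move=> uf0; apply: fhf; rewrite -[X in X ∗ h]fb -!convolutionA.
  by apply: convolution_vanishr; rewrite convolutionA.
Qed.

Lemma corners_dual_prime : dual_prime (D : set C).
Proof.
move=> f g fg; have [|f0] := EM (forall x, sset D x -> f x = 0); first by left.
right; apply: contrapT => g0.
have [a [b fab]] := component_exists f0; have [c [d gcd]] := component_exists g0.
have [u [fuc fu0]] := component_loopr (component_sandwich a b f) fab.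
have [v [vgc vg0]] := component_loopl (component_sandwich c d g) gcd.
have [||||h] := @component_prime a d a a d d _ _ _ _ _ _ fuc vgc fu0 vg0;
  try by [left | right].
(* The joined product contains f ∗ (...) ∗ g, which vanishes on [D] by [fg]; the ideal property
   disposes of the outer factors. *)
apply; rewrite convolution_regroup.
by apply/convolution_vanishr/convolution_vanishl; exact: fg.
Qed.

End Prime.
End PathFunctionals.

Theorem theorem4p3 (k : fieldType) (G : quiver)
    (D : subcoalgebra (path_coalgebra k G)) :
  prime_coalgebra (subcoalgebra_coalgebra D) <->
  (forall a b : vertex G,
     prime_coalgebra (subcoalgebra_coalgebra
       (corner_subcoalgebra (char_idempotent k [set a; b]) D))).
Proof.
split=> [/prime_subcoalgebraP Dprime a b | corners_prime].
  by apply/prime_cornerP => f g _ _ _ _; exact: Dprime.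
exact/prime_subcoalgebraP/corners_dual_prime.
Qed.
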